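(* Let $\alpha\in[0,1)$ and let $G$ be a connected graph of order $n$. Then $\mu_{\alpha}(G)\ge n-1$, with equality if and only if $G\cong K_n$.
   Context: All graphs are finite, simple and undirected; $K_n$ is the complete graph on $n$ vertices; $d_G(u,v)$ is the distance between $u$ and $v$ in the connected graph $G$. The transmission of a vertex $u$ is $T_G(u)=\sum_{v\in V(G)}d_G(u,v)$. Let $T(G)$ be the diagonal matrix of transmissions and $D(G)=(d_G(u,v))_{u,v\in V(G)}$ the distance matrix. For $\alpha\in[0,1)$, $D_{\alpha}(G)=\alpha T(G)+(1-\alpha)D(G)$, and $\mu_{\alpha}(G)$ (the distance $\alpha$-spectral radius) is the largest eigenvalue of the symmetric matrix $D_{\alpha}(G)$. *)

(* Defs.v *)
From mathcomp Require Import all_boot all_order all_algebra.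
From mathcomp Require Import boolp classical_sets reals.
From mathcomp Require complex.
Set Implicit Arguments.
Unset Strict Implicit.
Unset Printing Implicit Defensive.
Import Order.TTheory GRing.Theory Num.Theory.
Local Open Scope ring_scope.

Record sgraph := SGraph {
  vertex :> finType;
  adj : rel vertex;
  adj_sym : symmetric adj;
  adj_irrefl : irreflexive adj }.

(* The null graph is not considered connected. *)
Definition connected_graph (G : sgraph) : Prop :=
  (0 < #|G|)%N /\ forall u v : G, connect (@adj G) u v.

Definition graph_iso (G H : sgraph) : Prop :=
  exists2 f : G -> H, bijective f & forall u v, adj (f u) (f v) = adj u v.

Definition complete_adj n : rel 'I_n := fun i j => i != j.

Lemma complete_adj_sym n : symmetric (@complete_adj n).
Proof. by move=> i j; rewrite /complete_adj eq_sym. Qed.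

Lemma complete_adj_irrefl n : irreflexive (@complete_adj n).
Proof. by move=> i; rewrite /complete_adj eqxx. Qed.

Definition complete_graph n : sgraph :=
  SGraph (@complete_adj_sym n) (@complete_adj_irrefl n).

Section Distance.
Variable G : sgraph.

Definition walk_of_length (u v : G) (k : nat) : bool :=
  [exists p : k.-tuple G, path (@adj G) u p && (last u p == v)].

(* The least k < #|G| such that a walk of length k joins u to v; the value is
   #|G| when u and v lie in different components. *)
Definition gdist (u v : G) : nat :=
  find (walk_of_length u v) (iota 0 #|G|).

Lemma gdistP (u v : G) : connect (@adj G) u v ->
  walk_of_length u v (gdist u v) /\
  forall k, walk_of_length u v k -> (gdist u v <= k)%N.
Proof.
move=> /connectP[p0 pth lst].
have [k k_lt wk] : exists2 k, (k < #|G|)%N & walk_of_length u v k.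
  case/shortenP: pth lst => p pth up _ lst; exists (size p).
    by have := max_card (mem (u :: p)); rewrite (card_uniqP up).
  by apply/existsP; exists (in_tuple p); rewrite pth -lst eqxx.
have hs : has (walk_of_length u v) (iota 0 #|G|).
  by apply/hasP; exists k; rewrite ?mem_iota.
have lt_d : (gdist u v < #|G|)%N.
  by move: hs; rewrite has_find size_iota.
split; first by have := nth_find 0%N hs; rewrite nth_iota.
move=> j wj; rewrite leqNgt; apply/negP => j_lt.
have := before_find 0%N j_lt.
by rewrite nth_iota ?wj // (ltn_trans j_lt).
Qed.

Definition transmission (u : G) : nat := (\sum_(v : G) gdist u v)%N.

End Distance.

Section DistanceMatrices.
Variables (R : realType) (G : sgraph).

Definition transmission_mx : 'M[R]_#|G| :=
  diag_mx (\row_i (transmission (enum_val i))%:R).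

Definition distance_mx : 'M[R]_#|G| :=
  \matrix_(i, j) (gdist (enum_val i) (enum_val j))%:R.

Definition distance_alpha_mx (alpha : R) : 'M[R]_#|G| :=
  alpha *: transmission_mx + (1 - alpha) *: distance_mx.

End DistanceMatrices.

Section LargestEigenvalue.
Variables (R : realType) (n : nat).

Definition is_largest_eigenvalue (A : 'M[R]_n) (mu : R) : Prop :=
  eigenvalue A mu /\ forall a, eigenvalue A a -> a <= mu.

(* The default 0 is not used for symmetric A of positive size: see
   largest_eigenvalueP. *)
Definition largest_eigenvalue (A : 'M[R]_n) : R :=
  xget 0 [set mu | is_largest_eigenvalue A mu]%classic.

Import complex.
Local Open Scope complex_scope.

Lemma sym_eigenvalue_exists (A : 'M[R]_n) :
  (0 < n)%N -> A^T = A -> exists a, eigenvalue A a.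
Proof.
move=> n_gt0 symA; pose f := real_complex R : {rmorphism R -> R[i]}.
have [a eva] := eigenvalue_closed (map_mx f A) n_gt0.
have /eigenvalueP[v Av v_neq0] := eva.
pose w : 'cV[R[i]]_n := (map_mx (@conjc R) v)^T.
have conjA : map_mx (@conjc R) (map_mx f A) = map_mx f A.
  by apply/matrixP => i j; rewrite !mxE /= oppr0.
have Aw : map_mx f A *m w = conjc a *: w.
  apply: trmx_inj; rewrite trmx_mul trmxK map_trmx symA linearZ /= trmxK.
  rewrite -[in LHS]conjA -map_mxM Av; apply/matrixP=> i j.
  by rewrite !mxE rmorphM.
have vw_neq0 : (v *m w) 0 0 != 0.
  apply: contra v_neq0; rewrite mxE psumr_eq0 => [|i _]; last first.
    by rewrite !mxE -[conjc _]/((_ : R[i])^* )%R mul_conjC_ge0.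
  move=> /allP h; apply/eqP/rowP => i.
  have := h i (mem_index_enum _).
  by rewrite !mxE -[conjc _]/((_ : R[i])^* )%R mul_conjC_eq0 => /eqP.
have a_real : conjc a = a.
  have : (v *m map_mx f A *m w) 0 0 = (v *m map_mx f A *m w) 0 0 by [].
  rewrite {1}Av -mulmxA Aw -scalemxAl -scalemxAr !mxE.
  have -> : \sum_j v 0 j * w j 0 = (v *m w) 0 0 by rewrite mxE.
  by move=> /(mulIf vw_neq0).
exists (complex.Re a).
rewrite -(eigenvalue_map f).
suff -> : f (complex.Re a) = a by [].
case: a a_real {eva Av Aw} => x y [] /eqP.
by rewrite -subr_eq0 -opprD oppr_eq0 -mulr2n mulrn_eq0 /= => /eqP ->.
Qed.

Lemma largest_eigenvalueP (A : 'M[R]_n) :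
  (0 < n)%N -> A^T = A -> is_largest_eigenvalue A (largest_eigenvalue A).
Proof.
move=> n_gt0 symA; rewrite /largest_eigenvalue.
suff [mu mu_max] : exists mu, is_largest_eigenvalue A mu.
  exact: (@xgetPex _ _ [set mu | is_largest_eigenvalue A mu]%classic)
    (ex_intro _ mu mu_max).
have [a eva] := sym_eigenvalue_exists n_gt0 symA.
have p_neq0 : char_poly A != 0 by rewrite monic_neq0 ?char_poly_monic.
apply: contrapT => nomax.
have up b : eigenvalue A b -> exists2 c, eigenvalue A c & b < c.
  move=> evb; apply: contrapT => h; apply: nomax; exists b; split=> // c evc.
  by rewrite leNgt; apply/negP => bc; apply: h; exists c.
have [s [ss us evs]] : exists s : seq R,
    [/\ size s = size (char_poly A), uniq s & all (eigenvalue A) s].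
  suff H k : exists b s, [/\ size s = k, uniq s, all (eigenvalue A) s,
      eigenvalue A b & all (fun c => c < b) s].
    by have [b [s []]] := H (size (char_poly A)); exists s.
  elim: k => [|k [b [s [ss us evs evb sb]]]]; first by exists a, [::].
  have [c evc bc] := up _ evb; exists c, (b :: s); split=> //=.
  - by rewrite ss.
  - by rewrite us andbT; apply/negP => /(allP sb); rewrite ltxx.
  - by rewrite evb.
  - by rewrite bc; apply/allP => x /(allP sb) /lt_trans; apply.
have rts : all (root (char_poly A)) s.
  by apply/allP => x /(allP evs); rewrite eigenvalue_root_char.
by have := max_poly_roots p_neq0 rts us; rewrite ss ltnn.
Qed.

End LargestEigenvalue.

Definition distance_alpha_radius (R : realType) (alpha : R) (G : sgraph) : R :=
  largest_eigenvalue (distance_alpha_mx G alpha).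

Lemma gdist_sym (G : sgraph) (u v : G) : gdist u v = gdist v u.
Proof.
suff H x y k : walk_of_length x y k -> @walk_of_length G y x k.
  by apply: eq_find => k; apply/idP/idP; apply: H.
move=> /existsP[p /andP[pth /eqP lst]].
have sz : size (rev (belast x p)) == k by rewrite size_rev size_belast size_tuple.
apply/existsP; exists (Tuple sz) => /=.
rewrite -{1}lst rev_path (eq_path (e' := @adj G)) => [|a b]; last exact: adj_sym.
rewrite pth /=; case: (tval p) lst => [|z q] /= lst; first by rewrite lst.
by rewrite rev_cons last_rcons.
Qed.

Lemma distance_alpha_radiusP (R : realType) (alpha : R) (G : sgraph) :
  (0 < #|G|)%N ->
  is_largest_eigenvalue (distance_alpha_mx G alpha)
    (distance_alpha_radius alpha G).
Proof.
move=> G_gt0; apply: largest_eigenvalueP => //.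
apply/matrixP => i j; rewrite !mxE gdist_sym eq_sym.
by case: eqVneq => // ->.
Qed.

(* Main.v *)
Require Import Defs.
From mathcomp Require Import all_boot all_order all_algebra.
From mathcomp Require Import reals.
From mathcomp Require complex.
Import Order.TTheory GRing.Theory Num.Theory.
Local Open Scope ring_scope.

(** All row sums of the distance alpha-matrix are transmissions, so the Rayleigh
    quotient of the all-ones vector is the mean transmission.  A transmission
    is a sum of [n - 1] distances that are at least [1], whence the lower bound,
    and equality forces every distance to be [1], i.e. [G] complete.  Conversely
    in a complete graph every row sum is [n - 1], which bounds the eigenvalues
    of a nonnegative matrix from above. *)

Section Rayleigh.
Import complex.
Local Open Scope sesquilinear_scope.

(** Over [R[i]] the symmetric matrix becomes hermitian, hence unitarily diagonalizable with real
    diagonal [d]. In the rotated coordinates [y] the form is the sum of the [d 0 i] weighted by the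
    squared moduli of the [y 0 i], and each [d 0 i] is an eigenvalue of [A]. *)
Lemma rayleigh_le (R : rcfType) (n : nat) (A : 'M[R]_n) (mu : R) :
  A^T = A -> (forall a, eigenvalue A a -> a <= mu) ->
  forall x : 'rV[R]_n, (x *m A *m x^T) 0 0 <= mu * (x *m x^T) 0 0.
Proof.
move=> symA mu_max x; pose f := real_complex R : {rmorphism R -> R[i]}.
have f_real a : f a \is Num.real by apply/complex_realP; exists a.
have fC a : (f a)^* = f a by rewrite (CrealP (f_real a)).
pose B := map_mx f A.
have hermB : B \is hermsymmx.
  apply: realsym_hermsym; last by apply/mxOverP => i j; rewrite mxE.
  by apply/is_hermitianmxP; rewrite expr0 scale1r map_mx_id // map_trmx symA.
have realD := hermitian_spectral_diag_real hermB.
have /orthomx_spectralP := hermitian_normalmx hermB.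
move: realD (spectral_unitarymx B).
move: (spectralmx B) (spectral_diag B) => P d /mxOverP realD unitP defB.
(* Row [i] of [P] is a left eigenvector for [d 0 i], nonzero because [P] is invertible. As [d 0 i]
   is the image of a real [c], the eigenvalue descends to [A]. *)
have d_le i : d 0 i <= f mu.
  have /complex_realP[c def_c] := realD 0 i; rewrite def_c lecR.
  apply: mu_max; rewrite -(eigenvalue_map f) -[f c]def_c.
  apply/eigenvalueP; exists (row i P).
    rewrite -/B defB -row_mul !mulmxA mulmxV ?mul1mx ?unitarymx_unit //.
    by apply/rowP => j; rewrite mul_diag_mx !mxE.
  apply/eqP => Pi0; have /unitarymx_unit := unitP.
  move=> /mulmxV/(congr1 (row i)); rewrite row_mul Pi0 mul0mx => /rowP/(_ i).
  by rewrite !mxE eqxx => /eqP; rewrite eq_sym oner_eq0.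
pose z := map_mx f x; pose y := z *m P^t*.
have zC : z^t* = map_mx f x^T.
  by apply/matrixP => i j; rewrite !mxE fC.
have yC : y^t* = P *m z^t*.
  by rewrite /y trmx_mul map_mxM -[in RHS](trmxCK P).
have zz : z *m z^t* = y *m y^t*.
  by rewrite yC /y mulmxA mulmxKtV.
have zBz : z *m B *m z^t* = y *m diag_mx d *m y^t*.
  by rewrite yC /y defB invmx_unitary // !mulmxA.
rewrite -lecR -[_%:C%C]/(f _) -[(_ * _)%:C%C]/(f _) rmorphM /=.
have -> : f ((x *m A *m x^T) 0 0) = (z *m B *m z^t*) 0 0.
  by rewrite zC -!map_mxM [RHS]mxE.
have -> : f ((x *m x^T) 0 0) = (z *m z^t*) 0 0.
  by rewrite zC -!map_mxM [RHS]mxE.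
(* The comparison is termwise, each weight being a nonnegative [y 0 i * (y 0 i)^*]. *)
rewrite zBz zz mul_mx_diag !mxE mulr_sumr ler_sum // => i _.
rewrite !mxE mulrAC mulrC ler_wpM2r //.
exact: mul_conjC_ge0.
Qed.

End Rayleigh.

(** Read the eigenvector equation at a coordinate of largest modulus and apply the triangle
    inequality. Columns are summed because [eigenvalue] refers to row eigenvectors. *)
Lemma eigenvalue_le_colsum (R : realFieldType) (n : nat) (A : 'M[R]_n) (s a : R) :
  (forall i j, 0 <= A i j) -> (forall j, \sum_i A i j <= s) ->
  eigenvalue A a -> a <= s.
Proof.
move=> A_ge0 A_le /eigenvalueP[v vA v_neq0].
have /rV0Pn[i0 vi0] := v_neq0.
case: (@arg_maxP _ R _ i0 predT (fun i => `|v 0 i|)) => // i _ max_i.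
have v_max j : `|v 0 j| <= `|v 0 i| by exact: max_i.
have vi_gt0 : 0 < `|v 0 i|.
  by apply: lt_le_trans (v_max i0); rewrite normr_gt0.
rewrite -(ler_pM2r vi_gt0) (le_trans (ler_wpM2r (ltW vi_gt0) (ler_norm a))) //.
have := congr1 (fun w : 'rV_n => `|w 0 i|) vA; rewrite !mxE normrM => <-.
apply: le_trans (ler_norm_sum _ _ _) _.
apply: le_trans (ler_wpM2r (ltW vi_gt0) (A_le i)).
rewrite mulr_suml ler_sum // => j _.
by rewrite normrM (ger0_norm (A_ge0 _ _)) mulrC ler_wpM2l // v_max.
Qed.

Section Distance.
Variable G : sgraph.
Implicit Types u v : G.

Lemma walk_of_length0 u v : walk_of_length u v 0 = (u == v).
Proof.
apply/existsP/eqP => [[p]|->]; last by exists [tuple]; rewrite /= eqxx.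
by rewrite tuple0 => /eqP.
Qed.

Lemma walk_of_length1 u v : walk_of_length u v 1 = adj u v.
Proof.
apply/existsP/idP => [[p]|uv]; last by exists [tuple v]; rewrite /= uv eqxx.
by case/tupleP: p => w p; rewrite tuple0 /= andbT => /andP[uw /eqP<-].
Qed.

Lemma gdist_eq0 u v : connect (@adj G) u v -> (gdist u v == 0%N) = (u == v).
Proof.
case/gdistP=> wd d_le; apply/eqP/idP => [d0|uv].
  by rewrite -walk_of_length0 -d0.
by apply/eqP; rewrite -leqn0 d_le // walk_of_length0.
Qed.

Lemma gdist_eq1 u v : connect (@adj G) u v -> (gdist u v == 1%N) = adj u v.
Proof.
move=> uv; have [wd d_le] := gdistP uv; apply/eqP/idP => [d1|adj_uv].
  by rewrite -walk_of_length1 -d1.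
apply/eqP; rewrite eqn_leq d_le ?walk_of_length1 // lt0n gdist_eq0 //.
by apply: contraTN adj_uv => /eqP->; rewrite adj_irrefl.
Qed.

Lemma leq_gdist u v : connect (@adj G) u v -> ((u != v) <= gdist u v)%N.
Proof. by move=> uv; case: eqVneq => //= nuv; rewrite lt0n gdist_eq0. Qed.

Lemma sum_neq u : (\sum_v (u != v) = #|G|.-1)%N.
Proof.
rewrite -(cardC1 u) -sum1_card [RHS]big_mkcond.
by apply: eq_bigr => v _; rewrite inE eq_sym; case: eqP.
Qed.

Hypothesis G_connected : connected_graph G.

(** Each distance is compared with the indicator of [u != v]; [leqif_sum] collects the termwise
    equality conditions, which are automatic on the diagonal and mean adjacency off it. *)
Lemma leqif_sum_transmission :
  (#|G| * #|G|.-1 <= \sum_(u : G) transmission u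
     ?= iff [forall u : G, forall v : G, adj u v == (u != v)])%N.
Proof.
have [_ conn] := G_connected.
rewrite -sum_nat_const -(eq_bigr _ (fun u _ => sum_neq u)).
apply: leqif_sum => u _; apply: leqif_sum => v _; split; first exact: leq_gdist.
have [<-|nuv] := eqVneq u v; last by rewrite eq_sym gdist_eq1 //; case: adj.
by rewrite adj_irrefl eq_sym gdist_eq0 // eqxx.
Qed.

Lemma complete_iso :
  graph_iso G (complete_graph #|G|) <->
  [forall u : G, forall v : G, adj u v == (u != v)].
Proof.
split=> [[f f_bij f_adj]|/'forall_'forall_eqP adjE].
  apply/'forall_'forall_eqP => u v; rewrite -f_adj /= /complete_adj.
  by rewrite (inj_eq (bij_inj f_bij)).
exists (enum_rank : G -> complete_graph #|G|); first exact: enum_rank_bij.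
by move=> u v; rewrite adjE /= /complete_adj (inj_eq enum_rank_inj).
Qed.

Lemma complete_transmission :
  [forall u : G, forall v : G, adj u v == (u != v)] ->
  forall u : G, transmission u = #|G|.-1.
Proof.
have [_ conn] := G_connected.
move=> /'forall_'forall_eqP adjE u; rewrite -(sum_neq u); apply: eq_bigr => v _.
have [<-|nuv] := eqVneq u v; apply/eqP; first by rewrite gdist_eq0.
by rewrite gdist_eq1 // adjE.
Qed.

End Distance.

Lemma sym_distance_alpha_mx (R : realType) (alpha : R) (G : sgraph) :
  (distance_alpha_mx G alpha)^T = distance_alpha_mx G alpha.
Proof.
apply/matrixP => i j; rewrite !mxE gdist_sym eq_sym.
by case: eqVneq => // ->.
Qed.

(** The diagonal part contributes [alpha] times the transmission and the distance row [1 - alpha]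
    times it, so [alpha] cancels. *)
Lemma rowsum_distance_alpha_mx (R : realType) (alpha : R) (G : sgraph) i :
  \sum_j distance_alpha_mx G alpha i j = (transmission (enum_val i))%:R.
Proof.
under eq_bigr do rewrite !mxE.
rewrite big_split -!mulr_sumr /= (bigD1 i) //= eqxx big1 => [|j /negPf ji].
  rewrite addr0 mulr1n -natr_sum.
  rewrite /transmission (reindex _ (onW_bij _ (enum_val_bij G))) /=.
  by rewrite -mulrDl addrC subrK mul1r.
by rewrite eq_sym ji.
Qed.

Theorem theorem3p1 (R : realType) (alpha : R) (n : nat) (G : sgraph)
    (alpha_ge0 : 0 <= alpha) (alpha_lt1 : alpha < 1)
    (G_connected : connected_graph G) (G_order : #|G| = n) :
  n%:R - 1 <= distance_alpha_radius alpha G /\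
  (distance_alpha_radius alpha G = n%:R - 1 <-> graph_iso G (complete_graph n)).
Proof.
subst n; have [G_gt0 _] := G_connected.
have [ev_mu mu_max] := distance_alpha_radiusP alpha G_gt0.
set mu := distance_alpha_radius alpha G in ev_mu mu_max *.
(* The truncated predecessor is harmless since [G] is nonempty. *)
have predE : #|G|%:R - 1 = #|G|.-1%:R :> R by rewrite -subn1 natrB.
have n_gt0 : 0 < #|G|%:R :> R by rewrite ltr0n.
have mean_le : (\sum_(u : G) transmission u)%:R <= mu * #|G|%:R.
  pose e : 'rV[R]_#|G| := const_mx 1; have eE j : e 0 j = 1 by rewrite mxE.
  have ee : (e *m e^T) 0 0 = #|G|%:R.
    rewrite mxE (eq_bigr (fun=> 1)) => [|j _]; first by rewrite sumr_const card_ord.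
    by rewrite [_^T _ _]mxE eE mulr1.
  have eAe : (e *m distance_alpha_mx G alpha *m e^T) 0 0 =
      (\sum_(u : G) transmission u)%:R.
    rewrite -mulmxA mxE natr_sum (reindex _ (onW_bij _ (enum_val_bij G))) /=.
    apply: eq_bigr => i _.
    rewrite eE mul1r mxE -(rowsum_distance_alpha_mx R alpha).
    by apply: eq_bigr => j _; rewrite [_^T _ _]mxE eE mulr1.
  rewrite -eAe -ee.
  exact: rayleigh_le (sym_distance_alpha_mx R alpha G) mu_max e.
have [sum_ge sum_eq] := leqif_sum_transmission G G_connected.
have mu_ge : #|G|%:R - 1 <= mu.
  rewrite predE -(ler_pM2r n_gt0) -natrM mulnC.
  by apply: le_trans mean_le; rewrite ler_nat.
split=> //; rewrite complete_iso -sum_eq; split=> [mu_eq|sumE].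
  (* With [mu] equal to the bound, [mean_le] is the inequality opposite to [sum_ge]. *)
  rewrite eqn_leq sum_ge /= -(ler_nat R) natrM mulrC -predE -mu_eq.
  exact: mean_le.
apply/le_anti; rewrite mu_ge andbT.
apply: eigenvalue_le_colsum ev_mu => [i j|j].
  rewrite !mxE addr_ge0 ?mulr_ge0 ?subr_ge0 ?ler0n ?(ltW alpha_lt1) //.
  by case: eqP.
(* Symmetry turns the column sum into a row sum, that is, a transmission. *)
under eq_bigr do rewrite -sym_distance_alpha_mx mxE.
rewrite rowsum_distance_alpha_mx complete_transmission -?sum_eq //.
by rewrite predE.
Qed.
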